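(* There is a constant $C>0$ such that for every integer $t\ge 2$, if $\mathcal{P}$ is a finite poset whose comparability graph $G_{\mathcal{P}}$ has no $K_t$-minor, then $\dim(\mathcal{P})\le C t^2\log t$.
   Context: The comparability graph $G_{\mathcal{P}}$ of a poset $\mathcal{P}$ has the elements of $\mathcal{P}$ as vertices, two distinct elements being adjacent iff they are comparable. The dimension $\dim(\mathcal{P})$ is the minimum number of linear orders whose intersection is exactly the order of $\mathcal{P}$. *)

(* Defs.v *)
From mathcomp Require Import all_boot all_order.

Set Implicit Arguments.
Unset Strict Implicit.
Unset Printing Implicit Defensive.

Import Order.TTheory.

Record sgraph := SGraph {
  vertex : finType;
  adj : rel vertex;
  adj_sym : symmetric adj;
  adj_irr : irreflexive adj
}.

(* The subgraph of G induced by A is connected; as usual for connected graphs,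
   the empty one is excluded. *)
Definition connected_in (G : sgraph) (A : {set vertex G}) : Prop :=
  A != set0 /\
  {in A &, forall x y, connect [rel u v in A | adj u v] x y}.

(* A model of H in G: contracting each branch set B i to a single vertex, and
   deleting what is left over, turns G into H. *)
Definition graph_minor (H G : sgraph) : Prop :=
  exists B : vertex H -> {set vertex G},
    [/\ forall i, connected_in (B i),
        forall i j, i != j -> [disjoint B i & B j]
      & forall i j, adj i j ->
          exists x y, [/\ x \in B i, y \in B j & adj x y]].

Section CompleteGraph.
Variable t : nat.

Definition complete_adj : rel 'I_t := fun i j => i != j.

Lemma complete_adj_sym : symmetric complete_adj.
Proof. by move=> i j; rewrite /complete_adj eq_sym. Qed.

Lemma complete_adj_irr : irreflexive complete_adj.
Proof. by move=> i; rewrite /complete_adj eqxx. Qed.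

Definition complete_graph : sgraph := SGraph complete_adj_sym complete_adj_irr.

End CompleteGraph.

Section Poset.
Context {d : Order.disp_t} (P : finPOrderType d).

Definition comparability_adj : rel P :=
  fun x y => (x != y) && (x >=< y)%O.

Lemma comparability_adj_sym : symmetric comparability_adj.
Proof. by move=> x y; rewrite /comparability_adj eq_sym comparable_sym. Qed.

Lemma comparability_adj_irr : irreflexive comparability_adj.
Proof. by move=> x; rewrite /comparability_adj eqxx. Qed.

Definition comparability_graph : sgraph :=
  SGraph comparability_adj_sym comparability_adj_irr.

(* Relations on P are represented by their graphs, as subsets of P * P. *)
Definition partial_order (L : {set P * P}) : bool :=
  [&& [forall x, (x, x) \in L],
      [forall x, forall y, ((x, y) \in L) && ((y, x) \in L) ==> (x == y)]
    & [forall x, forall y, forall z,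
        ((x, y) \in L) && ((y, z) \in L) ==> ((x, z) \in L)]].

Definition linear_order (L : {set P * P}) : bool :=
  partial_order L &&
  [forall x, forall y, ((x, y) \in L) || ((y, x) \in L)].

Definition order_set : {set P * P} := [set p : P * P | (p.1 <= p.2)%O].

(* Realizers are nonempty families, so a chain has dimension 1, including
   when it has at most one element. *)
Definition realizer (R : {set {set P * P}}) : bool :=
  [&& R != set0,
      [forall L in R, linear_order L]
    & (\bigcap_(L in R) L) == order_set].

Lemma partial_orderP (L : {set P * P}) :
  reflect [/\ forall x, (x, x) \in L,
              forall x y, (x, y) \in L -> (y, x) \in L -> x = y
            & forall x y z, (x, y) \in L -> (y, z) \in L -> (x, z) \in L]
          (partial_order L).
Proof.
apply: (iffP and3P) => -[r a t]; split.
- exact/forallP.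
- move=> x y xy yx; move/forallP/(_ x)/forallP/(_ y): a.
  by rewrite xy yx => /eqP.
- move=> x y z xy yz.
  by move/forallP/(_ x)/forallP/(_ y)/forallP/(_ z): t; rewrite xy yz.
- exact/forallP.
- by apply/forallP => x; apply/forallP => y; apply/implyP => /andP[/a h /h ->].
- apply/forallP => x; apply/forallP => y; apply/forallP => z.
  by apply/implyP => /andP[/t]; apply.
Qed.

Lemma partial_order_extend (L : {set P * P}) (x y : P) :
  partial_order L -> (x, y) \notin L ->
  exists L', [/\ partial_order L', L \subset L' & (y, x) \in L'].
Proof.
move=> /partial_orderP[r a t] nxy.
exists [set p : P * P | (p \in L) || ((p.1, y) \in L) && ((x, p.2) \in L)].
split; last by rewrite inE /= !r orbT.
  apply/partial_orderP; split=> [u|u v|u v w]; rewrite !inE /= ?r //.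
  - case/orP=> [uv|/andP[uy xv]] /orP[vu|/andP[vy xu]].
    + exact: a.
    + by case/negP: nxy; apply: t xu (t _ _ _ uv vy).
    + by case/negP: nxy; apply: t xv (t _ _ _ vu uy).
    + by case/negP: nxy; apply: t xu uy.
  - case/orP=> [uv|/andP[uy xv]] /orP[vw|/andP[vy xw]].
    + by rewrite (t _ _ _ uv vw).
    + by rewrite (t _ _ _ uv vy) xw orbT.
    + by rewrite uy (t _ _ _ xv vw) orbT.
    + by rewrite uy xw orbT.
by apply/subsetP => p pL; rewrite inE pL.
Qed.

Lemma linear_order_extend (L : {set P * P}) :
  partial_order L -> exists2 L', linear_order L' & L \subset L'.
Proof.
move=> /maxset_exists[M /maxsetP[pM maxM] LM]; exists M => //.
rewrite /linear_order pM; apply/forallP => x; apply/forallP => y.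
have [//|nxy] := boolP ((x, y) \in M).
have [M' [pM' MM' yx]] := partial_order_extend pM nxy.
by rewrite -(maxM _ pM' MM').
Qed.

Lemma order_setP : partial_order order_set.
Proof.
apply/partial_orderP; split=> [x|x y|x y z]; rewrite !inE //=.
  by move=> xy yx; apply/le_anti; rewrite xy.
exact: le_trans.
Qed.

Definition linear_extensions : {set {set P * P}} :=
  [set L : {set P * P} | linear_order L && (order_set \subset L)].

Lemma linear_extensions_realizer : realizer linear_extensions.
Proof.
apply/and3P; split.
- have [L lL sL] := linear_order_extend order_setP.
  by apply/set0Pn; exists L; rewrite inE lL.
- by apply/forallP => L; apply/implyP; rewrite inE => /andP[].
- rewrite eqEsubset; apply/andP; split; last first.
    by apply/bigcapsP => L; rewrite inE => /andP[].
  apply/subsetP => -[x y] /bigcapP xyL; apply/negPn/negP => nxy.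
  have [M [pM sM yx]] := partial_order_extend order_setP nxy.
  have [L lL ML] := linear_order_extend pM.
  have xy : (x, y) \in L.
    by apply: xyL; rewrite inE lL (subset_trans sM ML).
  case/andP: lL => /partial_orderP[_ aL _] _.
  have exy : x = y by apply: aL xy (subsetP ML _ yx).
  by move: nxy; rewrite exy inE /= lexx.
Qed.

(* The set of all linear extensions seeds the search, and is a realizer by
   linear_extensions_realizer, so the minimum is a genuine one (poset_dimP). *)
Definition poset_dim : nat :=
  #|[arg min_(R < linear_extensions | realizer R) #|R|]%N|.

Lemma poset_dimP :
  (exists2 R, realizer R & #|R| = poset_dim) /\
  (forall R, realizer R -> (poset_dim <= #|R|)%N).
Proof.
rewrite /poset_dim; case: arg_minnP => [|R rR minR].
  exact: linear_extensions_realizer.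
by split=> //; exists R.
Qed.

End Poset.

(* Main.v *)
(* A [K_t]-minor-free graph and all its minors have average degree at most
   [D = O(t * sqrt (log t))] (Kostochka, Thomason).  Hence the comparability
   graph has an order [pos] in which each vertex has at most [D] earlier
   neighbours, and a proper colouring with [O(D ^ 2)] colours in which a vertex
   having an earlier neighbour of some colour has no other neighbour of that
   colour.  Each colour then gives two interval supergraphs of the comparability
   graph, which together separate all incomparable pairs, and each interval
   representation gives two linear extensions, read from left to right and from
   right to left; so the dimension is [O(D ^ 2) = O(t ^ 2 * log t)]. *)

Require Import Defs.
From mathcomp Require Import all_boot all_order all_algebra zify ring lra.

Set Implicit Arguments.
Unset Strict Implicit.
Unset Printing Implicit Defensive.

Import Order.TTheory.

(** * Minors and contractions *)

Definition deg (G : sgraph) (x : vertex G) := #|[set y | adj x y]|.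
Definition codeg (G : sgraph) (x y : vertex G) :=
  #|[set z | adj x z && adj y z]|.
(** Ordered pairs, so each edge counts twice and [arcs G] over the number of vertices is the average
    degree. *)
Definition arcs (G : sgraph) :=
  #|[set p : vertex G * vertex G | adj p.1 p.2]|.

Lemma arcs_sum_deg (G : sgraph) : arcs G = \sum_(x : vertex G) deg x.
Proof.
rewrite /arcs -sum1_card.
under eq_bigl do rewrite inE.
rewrite -(pair_big_dep xpredT (fun x y : vertex G => adj x y) (fun _ _ => 1)) /=.
apply: eq_bigr => x _; rewrite /deg -sum1_card.
by apply: eq_bigl => y; rewrite inE.
Qed.

Lemma connect_restr_sym (G : sgraph) (A : {set vertex G}) :
  connect_sym [rel u v in A | adj u v].
Proof.
by apply: sym_connect_sym => x y /=; rewrite adj_sym [(x \in A) && _]andbC.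
Qed.

Lemma connected_in_star (G : sgraph) (A : {set vertex G}) (x : vertex G) :
  x \in A ->
  (forall y, y \in A -> connect [rel u v in A | adj u v] x y) ->
  connected_in A.
Proof.
move=> xA h; split; first by apply/set0Pn; exists x.
move=> y z yA zA; apply: connect_trans (h z zA).
by rewrite connect_restr_sym h.
Qed.

Lemma connect_restr_mono (G : sgraph) (A B : {set vertex G}) x y :
  A \subset B ->
  connect [rel u v in A | adj u v] x y -> connect [rel u v in B | adj u v] x y.
Proof.
move=> sAB; apply: connect_sub => u v /= /andP[/andP[uA vA] uv].
by apply: connect1; rewrite /= !(subsetP sAB).
Qed.

(** Branch sets compose by union. A path inside [C i] lifts to the union: move within one [B j],
    then cross to the next along an edge given by [aB]. *)
Lemma graph_minor_trans (K H G : sgraph) :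
  graph_minor K H -> graph_minor H G -> graph_minor K G.
Proof.
move=> [C [cC dC aC]] [B [cB dB aB]].
exists (fun i => \bigcup_(j in C i) B j); split.
- move=> i; have [/set0Pn[a aCi] con] := cC i.
  have [/set0Pn[x xa] _] := cB a.
  split; first by apply/set0Pn; exists x; apply/bigcupP; exists a.
  move=> u v /bigcupP[j jC uj] /bigcupP[k kC vk].
  have sub l : l \in C i -> B l \subset \bigcup_(j in C i) B j.
    by move=> lC; apply: bigcup_sup.
  have inner l : l \in C i -> {in B l &, forall y z,
      connect [rel u v in \bigcup_(j in C i) B j | adj u v] y z}.
    move=> lC y z yl zl; apply: (connect_restr_mono (sub l lC)).
    by have [_ h] := cB l; apply: h.
  have /connectP[p pP kE] := con j k jC kC.
  elim: p j jC u uj pP kE => [|l p IH] j jC u uj /=.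
    by move=> _ kE; subst k; apply: (inner j).
  move=> /andP[/andP[/andP[_ lC] jl] pP] kE.
  have [y [z [yj zl yz]]] := aB _ _ jl.
  apply: connect_trans (inner j jC u y uj yj) _.
  apply: connect_trans (IH l lC z zl pP kE).
  apply: connect1 => /=.
  by rewrite (subsetP (sub j jC) _ yj) (subsetP (sub l lC) _ zl) yz.
- move=> i j ij; apply/pred0P => x /=; apply/negP.
  move=> /andP[/bigcupP[a aC' xa] /bigcupP[b bC xb]].
  have ab : a != b.
    apply/eqP => ab; subst b; have /pred0P/(_ a) := dC _ _ ij.
    by rewrite /= aC' bC.
  by have /pred0P/(_ x) := dB _ _ ab; rewrite /= xa xb.
- move=> i j ij; have [a [b [aCi bCj ab]]] := aC _ _ ij.
  have [x [y [xa yb xy]]] := aB _ _ ab.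
  exists x, y; split=> //; apply/bigcupP; first by exists a.
  by exists b.
Qed.

(** * Quotients by branch sets: induced subgraphs and edge contractions *)

Section BranchGraph.
Variables (G : sgraph) (I : finType) (B : I -> {set vertex G}).

Definition branch_adj : rel I := fun i j =>
  (i != j) && [exists x in B i, exists y in B j, adj x y].

Lemma branch_adjP i j :
  reflect (i != j /\ exists x y, [/\ x \in B i, y \in B j & adj x y])
          (branch_adj i j).
Proof.
apply: (iffP andP) => -[ij].
  move=> /existsP[x /andP[xi /existsP[y /andP[yj xy]]]]; split=> //.
  by exists x, y.
move=> [x [y [xi yj xy]]]; split=> //.
apply/existsP; exists x; rewrite xi; apply/existsP; exists y.
by rewrite yj.
Qed.

Lemma branch_adj_sym : symmetric branch_adj.
Proof.
have h i j : branch_adj i j -> branch_adj j i.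
  move=> /branch_adjP[ij [x [y [xi yj xy]]]]; apply/branch_adjP.
  by rewrite eq_sym; split=> //; exists y, x; rewrite adj_sym.
by move=> i j; apply/idP/idP; apply: h.
Qed.

Lemma branch_adj_irr : irreflexive branch_adj.
Proof. by move=> i; rewrite /branch_adj eqxx. Qed.

Definition branch_graph := SGraph branch_adj_sym branch_adj_irr.

Lemma branch_graph_minor :
  (forall i, connected_in (B i)) ->
  (forall i j, i != j -> [disjoint B i & B j]) ->
  graph_minor branch_graph G.
Proof.
by move=> cB dB; exists B; split=> // i j /branch_adjP[].
Qed.

End BranchGraph.

Lemma connected_in1 (G : sgraph) (x : vertex G) : connected_in [set x].
Proof.
by apply: (@connected_in_star _ _ x) => [|y]; rewrite ?set11 // => /set1P->.
Qed.

(** Encoded as a quotient by singleton branch sets, so that [branch_graph_minor] applies. *)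
Definition induced (G : sgraph) (A : {set vertex G}) : sgraph :=
  branch_graph (fun u : {x | x \in A} => [set val u]).

Lemma induced_minor (G : sgraph) (A : {set vertex G}) :
  graph_minor (induced A) G.
Proof.
apply: branch_graph_minor => [u|u v uv]; first exact: connected_in1.
by rewrite disjoints1 inE.
Qed.

Lemma induced_adj (G : sgraph) (A : {set vertex G}) (u v : vertex (induced A)) :
  adj u v = adj (val u) (val v).
Proof.
apply/branch_adjP/idP => [[_ [x [y [/set1P-> /set1P->]]]]|uv] //.
split; first by apply: contraTneq uv => ->; rewrite adj_irr.
by exists (val u), (val v); rewrite !set11.
Qed.

Lemma card_induced (G : sgraph) (A : {set vertex G}) :
  #|vertex (induced A)| = #|A|.
Proof. exact: card_sig. Qed.

Lemma deg_induced (G : sgraph) (A : {set vertex G}) (u : vertex (induced A)) :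
  deg u = #|[set y in A | adj (val u) y]|.
Proof.
pose f : vertex (induced A) -> vertex G := val.
have fI : injective f := val_inj.
rewrite /deg -(card_imset _ fI); apply: eq_card => y.
apply/imsetP/idP => [[v]|].
  by rewrite inE induced_adj => uv ->; rewrite inE uv andbT (valP v).
rewrite inE => /andP[yA uy]; exists (exist _ y yA : vertex (induced A)) => //.
by rewrite inE induced_adj.
Qed.

Lemma arcs_delete (G : sgraph) (x : vertex G) :
  arcs G <= arcs (induced [set~ x]) + 2 * deg x.
Proof.
pose A := [set p : vertex G * vertex G | adj p.1 p.2].
pose A' := [set p in A | (p.1 != x) && (p.2 != x)].
have sub : A \subset A' :|: (setX [set x] [set y | adj x y] :|:
                        setX [set y | adj x y] [set x]).
  apply/subsetP => -[a b]; rewrite !inE /= => ab.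
  have [ax|ax] := eqVneq a x; first by rewrite -ax ab orbT.
  have [bx|bx] := eqVneq b x; first by rewrite -bx [adj b a]adj_sym ab !orbT.
  by rewrite ab.
apply: leq_trans (subset_leq_card sub) _.
apply: leq_trans (leq_card_setU _ _) _.
apply: leq_add; last first.
  by apply: leq_trans (leq_card_setU _ _) _; rewrite !cardsX cards1 /deg; lia.
rewrite /arcs.
pose f (p : vertex (induced [set~ x]) * vertex (induced [set~ x])) :=
  (val p.1, val p.2).
apply: leq_trans (leq_imset_card f _).
apply/subset_leq_card/subsetP => -[a b]; rewrite !inE /=.
move=> /andP[ab /andP[ax bx]].
have ax' : a \in [set~ x] by rewrite !inE.
have bx' : b \in [set~ x] by rewrite !inE.
pose u : vertex (induced [set~ x]) := exist _ a ax'.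
pose v : vertex (induced [set~ x]) := exist _ b bx'.
have uv : adj u v by rewrite induced_adj.
by apply/imsetP; exists (u, v); rewrite ?in_set.
Qed.

Section Contract.
Variables (G : sgraph) (x y : vertex G).
Hypothesis xy : adj x y.

Definition contract_branch (u : {z | z \in [set~ y]}) :=
  if val u == x then [set x; y] else [set val u].

Definition contract : sgraph := branch_graph contract_branch.

Lemma card_contract : #|vertex contract| = #|vertex G|.-1.
Proof. by rewrite card_sig cardsC1. Qed.

Lemma contract_minor : graph_minor contract G.
Proof.
apply: branch_graph_minor => [u|u v uv]; rewrite /contract_branch.
  case: eqP => _; last exact: connected_in1.
  apply: (@connected_in_star _ _ x) => [|z]; first by rewrite !inE eqxx.
  rewrite !inE => /orP[]/eqP-> //; apply: connect1.
  by rewrite /= !inE !eqxx xy orbT.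
have uy : val u != y by have := valP u; rewrite !inE.
have vy : val v != y by have := valP v; rewrite !inE.
have uv' : val u != val v by [].
apply/pred0P => z /=; apply/negP.
have [ux|ux] := eqVneq (val u) x; have [vx|vx] := eqVneq (val v) x;
  rewrite !inE => /andP[].
- by move: uv'; rewrite ux vx eqxx.
- by move=> h /eqP zv; move: h; rewrite zv (negbTE vx) (negbTE vy).
- by move=> /eqP->; rewrite (negbTE ux) (negbTE uy).
- by move=> /eqP->; rewrite (negbTE uv').
Qed.

(** Lost are [xy] and, for each common neighbour [z], the edge [yz], which merges with [xz]; each is
    two arcs. *)
Lemma arcs_contract : arcs G <= arcs contract + 2 * (codeg x y).+1.
Proof.
have xNy : x != y by apply: contraTneq xy => ->; rewrite adj_irr.
pose A := [set p : vertex G * vertex G | adj p.1 p.2].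
pose N := x |: [set z | adj x z && adj y z].
pose bad := setX [set y] N :|: setX N [set y].
have cN : #|N| <= (codeg x y).+1 by rewrite cardsU1; case: (_ \in _).
have cbad : #|bad| <= 2 * (codeg x y).+1.
  by apply: leq_trans (leq_card_setU _ _) _; rewrite !cardsX !cards1; lia.
suff h : #|A :\: bad| <= arcs contract.
  rewrite /arcs -/A -(cardsID bad A) addnC; apply: leq_add h _.
  by apply: leq_trans cbad; apply: subset_leq_card; apply: subsetIr.
have xin : x \in [set~ y] by rewrite !inE.
(* [y] lies outside the subtype, so [insubd] sends it to the default [x]. *)
pose g (z : vertex G) : vertex contract := insubd (exist _ x xin : {z | z \in [set~ y]}) z.
have gv z : val (g z) = if z == y then x else z.
  by rewrite /g val_insubd !inE; case: eqP.
have gB z : z \in contract_branch (g z).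
  rewrite /contract_branch gv; case: (eqVneq z y) => [->|zy].
    by rewrite eqxx !inE eqxx orbT.
  by case: eqP => [->|_]; rewrite !inE eqxx.
pose f (p : vertex G * vertex G) := (g p.1, g p.2).
have bad1 b : adj y b -> (y, b) \notin bad -> b != x /\ ~~ adj x b.
  move=> yb; rewrite !inE /= eqxx yb /= !andbT !negb_or.
  by move=> /andP[/andP[]].
have bad2 a : adj a y -> (a, y) \notin bad -> a != x /\ ~~ adj x a.
  rewrite adj_sym => ya; rewrite !inE /= eqxx ya /= !andbT !negb_or.
  by move=> /andP[_ /andP[]].
(* Distinct arcs with equal images differ by exchanging [x] and [y] at an end, so one of them joins
   [y] to [x] or to a common neighbour and lies in [bad]. *)
have inj : {in A :\: bad &, injective f}.
  move=> [a b] [c d] /setDP[+ nab] /setDP[]; rewrite ![_ \in A]inE /= => ab cd ncd.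
  move=> [/(congr1 val) + /(congr1 val)]; rewrite !gv.
  have [ay|ay] := eqVneq a y.
    have [bx xb] : b != x /\ ~~ adj x b by apply: bad1; rewrite -ay.
    rewrite (_ : (b == y) = false); last first.
      by apply: contraTF ab => /eqP->; rewrite ay adj_irr.
    have [cy|cy] := eqVneq c y.
      rewrite (_ : (d == y) = false); last first.
        by apply: contraTF cd => /eqP->; rewrite cy adj_irr.
      by move=> _ <-; rewrite ay cy.
    move=> xc; have [dy|dy] := eqVneq d y => bd; first by rewrite bd eqxx in bx.
    by rewrite xc bd cd in xb.
  have [cy|cy] := eqVneq c y.
    have [dx xd] : d != x /\ ~~ adj x d by apply: bad1; rewrite -cy.
    rewrite (_ : (d == y) = false); last first.
      by apply: contraTF cd => /eqP->; rewrite cy adj_irr.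
    move=> ax; have [bY|bY] := eqVneq b y => bd; first by rewrite -bd eqxx in dx.
    by rewrite -ax -bd ab in xd.
  move=> ac; have [bY|bY] := eqVneq b y; have [dy|dy] := eqVneq d y.
  - by rewrite ac bY dy.
  - have [_ xa] : a != x /\ ~~ adj x a by apply: bad2; rewrite -bY.
    by move=> xd; rewrite ac adj_sym xd cd in xa.
  - have [_ xc] : c != x /\ ~~ adj x c by apply: bad2; rewrite -dy.
    by move=> bx; rewrite -ac adj_sym -bx ab in xc.
  - by move=> ->; rewrite ac.
rewrite -(card_in_imset inj); apply/subset_leq_card/subsetP => q /imsetP[[a b]].
rewrite !inE /= => /andP[n1 ab] ->; rewrite /f /=; apply/branch_adjP; split.
  apply: contraTneq n1 => /(congr1 val); rewrite !gv.
  have [ay|ay] := eqVneq a y; have [by'|by'] := eqVneq b y; subst.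
  - by move: ab; rewrite adj_irr.
  - by move=> <-; rewrite eqxx.
  - by move=> ->; rewrite eqxx !orbT.
  - by move=> e; move: ab; rewrite e adj_irr.
by exists a, b; rewrite !gB.
Qed.

End Contract.

(** Delete vertices and contract edges as long as the inequality survives; once no such step is
    possible, the arcs lost by each step give the two lower bounds. *)
Lemma minimal_minor (F : nat -> nat) (K : nat) (G : sgraph) :
  F #|vertex G| <= K * arcs G ->
  exists H : sgraph,
    [/\ graph_minor H G, F #|vertex H| <= K * arcs H,
        forall x : vertex H,
          K * arcs H < F #|vertex H|.-1 + K * (2 * deg x)
      & forall x y : vertex H, adj x y ->
          K * arcs H < F #|vertex H|.-1 + K * (2 * (codeg x y).+1)].
Proof.
have [n le_n] := ubnP #|vertex G|; elim: n G le_n => // n IH G le_n FG.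
have shrink (H : sgraph) m : graph_minor H G -> #|vertex H| = #|vertex G|.-1 ->
    0 < #|vertex G| -> arcs G <= arcs H + m ->
    F #|vertex G|.-1 + K * m <= K * arcs G ->
    exists H : sgraph,
    [/\ graph_minor H G, F #|vertex H| <= K * arcs H,
        forall x : vertex H,
          K * arcs H < F #|vertex H|.-1 + K * (2 * deg x)
      & forall x y : vertex H, adj x y ->
          K * arcs H < F #|vertex H|.-1 + K * (2 * (codeg x y).+1)].
  move=> mH cH G0 aH FH.
  have [||H' [m' ? ? ?]] := IH H; first by rewrite cH; lia.
    by rewrite cH; nia.
  by exists H'; split=> //; apply: graph_minor_trans mH.
case: (pickP [pred x : vertex G | F #|vertex G|.-1 + K * (2 * deg x) <= K * arcs G])
  => [x /= hx|nx].
  apply: (shrink (induced [set~ x]) (2 * deg x)) => //.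
  - exact: induced_minor.
  - by rewrite card_induced cardsC1.
  - by apply/card_gt0P; exists x.
  - exact: arcs_delete.
case: (pickP [pred p : vertex G * vertex G | adj p.1 p.2 &&
   (F #|vertex G|.-1 + K * (2 * (codeg p.1 p.2).+1) <= K * arcs G)])
  => [[x y] /= /andP[xy hx]|nxy].
  apply: (shrink (contract x y) (2 * (codeg x y).+1)) => //.
  - exact: contract_minor.
  - exact: card_contract.
  - by apply/card_gt0P; exists x.
  - exact: arcs_contract.
exists G; split=> //.
- by exists (fun x => [set x]); split=> [x|x y xy|x y xy];
    [exact: connected_in1|rewrite disjoints1 inE|exists x, y; rewrite !set11].
- by move=> x; rewrite ltnNge; apply/negP => h; have := nx x; rewrite /= h.
- move=> x y xy; rewrite ltnNge; apply/negP => h.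
  by have := nxy (x, y); rewrite /= xy h.
Qed.

(** * Dense minors *)

Lemma arcs_le (G : sgraph) : arcs G <= #|vertex G| * #|vertex G|.
Proof. by rewrite -card_prod max_card. Qed.

Lemma deg_lt_card (G : sgraph) (x : vertex G) : deg x < #|vertex G|.
Proof.
rewrite -cardsT; apply: proper_card; apply/properP; split; first exact: subsetT.
by exists x; rewrite !inE ?adj_irr.
Qed.

Lemma exists_deg_le_average (G : sgraph) : 0 < #|vertex G| ->
  exists v : vertex G, #|vertex G| * deg v <= arcs G.
Proof.
move=> /card_gt0P[v0 _].
have [v _ minv] := @arg_minnP _ v0 xpredT (@deg G) isT.
exists v; rewrite arcs_sum_deg -sum_nat_const.
by apply: leq_sum => x _; apply: minv.
Qed.

Lemma deg_neighbourhood (G : sgraph) (v : vertex G)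
    (u : vertex (induced [set y | adj v y])) :
  adj v (val u) /\ deg u = codeg v (val u).
Proof.
split; first by have := valP u; rewrite inE.
by rewrite deg_induced; apply: eq_card => y; rewrite !inE.
Qed.

(* In a minimal minor with [arcs >= D * n] each edge lies in at least about
   [D / 2] triangles, while some vertex has degree at most the average. *)
Lemma half_dense_minor (G : sgraph) (D : nat) :
  0 < D -> 0 < #|vertex G| -> D * #|vertex G| <= arcs G ->
  exists H : sgraph, [/\ graph_minor H G, D <= 2 * #|vertex H| &
    forall x : vertex H, #|vertex H| <= 2 * deg x + 1].
Proof.
(* The summand [n == 0] rules out the empty minor, which has no arcs. *)
move=> D0 G0 aG; pose F n := D * n + (n == 0).
have [|H [mH FH delH conH]] := @minimal_minor F 1 G.
  by rewrite /F; lia.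
rewrite /F in FH delH conH.
have aH := arcs_le H.
have H0 : 0 < #|vertex H| by case: posnP FH aH => // ->; lia.
have [v dv] := exists_deg_le_average H0.
have delv := delH v.
have n2 : 1 < #|vertex H|.
  rewrite ltn_neqAle H0 andbT; apply/eqP => n1.
  by move: delv FH (deg_lt_card v); rewrite -n1 /=; lia.
have cN : #|[set y | adj v y]| = deg v by [].
exists (induced [set y | adj v y]); rewrite card_induced cN.
move: FH delv dv conH n2 {delH aH}.
case: #|vertex H| H0 => // n _; rewrite /= mulnS !mul1n => FH delv dv conH n2.
have n0 : (n == 0) = false by lia.
rewrite n0 addn0 in delv.
split.
- exact: graph_minor_trans (induced_minor _) mH.
- by lia.
- move=> u; have [vu ->] := deg_neighbourhood u.
  have := conH _ _ vu; rewrite n0 addn0 mul1n => cu.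
  (* Here [H] has [n.+1] vertices. The excess [x = arcs H - D * n] is at least [D], so
     [arcs H <= n.+1 * x], and [deg v] is at most the average. *)
  suff : deg v <= arcs H - D * n by lia.
  have [x aE] : exists x, arcs H = D * n + x by exists (arcs H - D * n); lia.
  rewrite aE addKn -(leq_pmul2l (ltn0Sn n)).
  by have : n * D <= n * x; [rewrite leq_mul2l; lia|lia].
Qed.

(* In a minor on [m] vertices minimal for [20 * arcs >= n0 ^ 2 - 10 * n0 + 9 * m ^ 2],
   either all degrees are at least [3 m / 5], or a vertex of smaller degree has a
   neighbourhood of that kind, as each edge lies in about [9 m / 20] triangles. *)
Lemma densify (G : sgraph) :
  100 <= #|vertex G| -> (forall x : vertex G, #|vertex G| <= 2 * deg x + 1) ->
  exists H : sgraph, [/\ graph_minor H G, #|vertex G| <= 15 * #|vertex H| &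
    forall x : vertex H, 3 * #|vertex H| <= 5 * deg x].
Proof.
move: {2 3 4}#|vertex G| (erefl #|vertex G|) => n0 cG n0_ge degG.
pose F m := n0 * (n0 - 10) + 9 * (m * m).
(* Since [F n0 = 10 * n0 * (n0 - 1)], this is [F n0 <= 20 * arcs G]. *)
have aG : n0 * (n0 - 1) <= 2 * arcs G.
  rewrite arcs_sum_deg big_distrr /= -{1}cG -sum_nat_const.
  by apply: leq_sum => x _; have := degG x; lia.
have [|H [mH FH delH conH]] := @minimal_minor F 20 G.
  by rewrite /F cG; nia.
rewrite /F in FH delH conH.
have aH := arcs_le H.
(* With [m] vertices, [arcs H <= m * m] leaves [n0 * (n0 - 10) <= 11 * (m * m)]: the constant term
   of [F] keeps the minor large. *)
have mn : n0 <= 5 * #|vertex H| by nia.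
have [h|/forallPn[v]] := boolP [forall x : vertex H, 3 * #|vertex H| <= 5 * deg x].
  by exists H; split=> //; [lia|apply/forallP].
rewrite -ltnNge => dv; have delv := delH v.
exists (induced [set y | adj v y]); rewrite card_induced; split.
- exact: graph_minor_trans (induced_minor _) mH.
- by move: delv FH; rewrite -/(deg v); nia.
- move=> u; have [vu ->] := deg_neighbourhood u.
  by have := conH _ _ vu; rewrite -/(deg v); nia.
Qed.

Lemma dense_minor (G : sgraph) (D : nat) :
  200 <= D -> 0 < #|vertex G| -> D * #|vertex G| <= arcs G ->
  exists H : sgraph, [/\ graph_minor H G, D <= 30 * #|vertex H| &
    forall x : vertex H, 3 * #|vertex H| <= 5 * deg x].
Proof.
move=> D200 G0 aG; have D0 : 0 < D by lia.
have [H [mH DH dH]] := half_dense_minor D0 G0 aG.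
have H100 : 100 <= #|vertex H| by lia.
have [K [mK HK dK]] := densify H100 dH.
exists K; split=> //; first exact: graph_minor_trans mK mH.
by lia.
Qed.

(** * Clique minors *)

Lemma leq_card_bigcup_sum (I T : finType) (A : pred I) (F : I -> {set T}) :
  #|\bigcup_(i | A i) F i| <= \sum_(i | A i) #|F i|.
Proof.
elim/big_rec2: _ => [|i a b _ ab]; first by rewrite cards0.
by apply: leq_trans (leq_card_setU _ _).1 _; rewrite leq_add2l.
Qed.

Lemma leq_expl (a b s : nat) : a <= b -> a ^ s <= b ^ s.
Proof. by case: s => // s ab; rewrite leq_exp2r. Qed.

(* First moment: a random map ['I_s -> W] misses a given neighbourhood with
   probability at most [2 ^- s], and falls into a given [U i] with probability
   at most [(8 / 2 ^ s) ^ s]. *)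
Lemma random_bag (V : finType) (N : V -> {set V}) (W : {set V})
    (I : finType) (U : I -> {set V}) (s : nat) :
  0 < #|V| -> #|V| <= 2 * #|W| ->
  (forall v, 2 * #|W :\: N v| <= #|W|) ->
  (forall i, 2 ^ s * #|U i| <= 4 * #|V|) ->
  2 * #|I| * 8 ^ s <= 2 ^ (s * s) ->
  exists f : {ffun 'I_s -> V},
    [/\ forall k, f k \in W,
        forall i, exists k, f k \notin U i
      & 2 ^ s * #|[set v | [forall k, f k \notin N v]]| <= 4 * #|V|].
Proof.
move=> V0 VW WN UV Is; set w := #|W| in VW WN *; set n := #|V| in V0 VW UV *.
pose und (f : {ffun 'I_s -> V}) := [set v | [forall k, f k \notin N v]].
pose Om := [set f : {ffun 'I_s -> V} | f \in ffun_on (mem W)].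
pose bad1 i := [set f : {ffun 'I_s -> V} | f \in ffun_on (mem (U i))].
pose bad2 := [set f in Om | 4 * n < 2 ^ s * #|und f|].
have cOm : #|Om| = w ^ s by rewrite cardsE card_ffun_on card_ord.
have cb1 i : #|bad1 i| = #|U i| ^ s by rewrite cardsE card_ffun_on card_ord.
have w0 : 0 < w by lia.
have ws0 : 0 < w ^ s by rewrite expn_gt0 w0.
have b1 : 2 * \sum_i #|bad1 i| <= w ^ s.
  have p0 : 0 < 2 ^ (s * s) by rewrite expn_gt0.
  rewrite -(leq_pmul2l p0).
  apply: leq_trans (_ : 2 * #|I| * 8 ^ s * w ^ s <= _); last by rewrite leq_mul2r Is orbT.
  rewrite mulnCA -!mulnA leq_mul2l /= big_distrr /= -sum_nat_const.
  apply: leq_sum => i _; rewrite cb1 expnM -!expnMn leq_expl //.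
  by apply: leq_trans (UV i) _; lia.
(* Markov's inequality: count the pairs of a map [f] and a vertex [v] whose neighbourhood [f]
   misses, first by [f], then by [v]. *)
have b2 : 4 * #|bad2| <= w ^ s.
  rewrite -(leq_pmul2l V0) mulnA [n * 4]mulnC.
  have -> : 4 * n * #|bad2| = \sum_(f in bad2) 4 * n by rewrite sum_nat_const mulnC.
  apply: leq_trans (_ : \sum_(f in Om) 2 ^ s * #|und f| <= _).
    rewrite [X in _ <= X](big_setID bad2) /=.
    apply: leq_trans (leq_addr _ _).
    rewrite (_ : Om :&: bad2 = bad2); last first.
      by apply/setIidPr/subsetP => f; rewrite inE => /andP[].
    by apply: leq_sum => f; rewrite inE => /andP[_ /ltnW].
  rewrite -big_distrr /=.
  have -> : \sum_(f in Om) #|und f| =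
      \sum_v #|[set f in Om | [forall k, f k \notin N v]]|.
    under eq_bigr do rewrite -sum1_card big_mkcond /=.
    rewrite exchange_big /=; apply: eq_bigr => v _.
    by rewrite -sum1_card -big_mkcondr; apply: eq_bigl => f; rewrite !inE.
  rewrite big_distrr /= -sum_nat_const; apply: leq_sum => v _.
  apply: leq_trans (_ : 2 ^ s * #|W :\: N v| ^ s <= _); last first.
    by rewrite -expnMn leq_expl.
  rewrite leq_mul2l; apply/orP; right.
  rewrite -[s in X in _ <= X]card_ord -card_ffun_on.
  apply/subset_leq_card/subsetP => f; rewrite !inE => /andP[/ffun_onP fW /forallP fN].
  by apply/ffun_onP => k; rewrite !inE fN fW.
(* The bad maps number at most [1/2 + 1/4] of [Om]. *)
have [f fOm fb] : exists2 f, f \in Om & f \notin bad2 :|: \bigcup_i bad1 i.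
  apply/subsetPn; apply/negP => /subset_leq_card.
  have h1 := (leq_card_setU bad2 (\bigcup_i bad1 i)).1.
  have h2 : #|\bigcup_i bad1 i| <= \sum_i #|bad1 i| := leq_card_bigcup_sum _ _.
  by rewrite cOm; lia.
move: fb; rewrite in_setU negb_or => /andP[nb2 nb1]; exists f; split.
- by move: fOm; rewrite inE => /ffun_onP.
- move=> i; apply/existsP; apply: contraR nb1; rewrite negb_exists => /forallP h.
  apply/bigcupP; exists i => //; rewrite inE; apply/ffun_onP => k.
  by have := h k; rewrite negbK.
- by move: nb2; rewrite inE fOm /= -leqNgt.
Qed.

Definition undominated (G : sgraph) (A : {set vertex G}) :=
  [set v | [forall u in A, ~~ adj v u]].

Section DenseGraph.
Variables (G : sgraph) (s t : nat).
Let n := #|vertex G|.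
Hypothesis G0 : 0 < n.
Hypothesis dense : forall x : vertex G, 3 * n <= 5 * deg x.
Hypothesis s0 : 0 < s.
Hypothesis small : 2 * t * 8 ^ s <= 2 ^ (s * s).

(** Two neighbourhoods of size at least [3n/5] share at least [n/5] vertices, more than [X] has. *)
Lemma common_neighbour (X : {set vertex G}) (x y : vertex G) :
  10 * #|X| <= n -> exists z, [/\ z \notin X, adj x z & adj y z].
Proof.
move=> Xn; pose N x := [set z : vertex G | adj x z].
have Nd z : #|N z| = deg z by [].
have := cardsUI (N x) (N y); rewrite !Nd => cU.
have := max_card (N x :|: N y); rewrite -/n => mU.
have : ~~ (N x :&: N y \subset X).
  apply/negP => /subset_leq_card; have := dense x; have := dense y; lia.
move=> /subsetPn[z]; rewrite !inE => /andP[xz yz] zX.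
by exists z.
Qed.

(** Take [s] random vertices outside [X] and join each to the first through a common neighbour.
    Non-neighbours of a vertex number at most [2n/5], less than half of the [9n/10] vertices
    available, as [random_bag] requires. *)
Lemma new_bag (X : {set vertex G}) (I : finType) (U : I -> {set vertex G}) :
  10 * #|X| <= n -> #|I| <= t -> (forall i, 2 ^ s * #|U i| <= 4 * n) ->
  exists S : {set vertex G},
    [/\ connected_in S, [disjoint X & S], #|S| <= 2 * s,
        2 ^ s * #|undominated S| <= 4 * n & forall i, ~~ (S \subset U i)].
Proof.
move=> Xn It Un; pose N x := [set z : vertex G | adj x z].
have Nd z : #|N z| = deg z by [].
have cX := cardsC X; rewrite -/n in cX.
have [|v||f [fX fU fund]] := @random_bag _ N (~: X) I U s G0 _ _ Un.
- by rewrite -/n; lia.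
- have := dense v; have := cardsC (N v); rewrite Nd -/n => cN dv.
  have : #|~: X :\: N v| <= #|~: N v|.
    by apply/subset_leq_card/subsetP => z; rewrite !inE => /andP[].
  by lia.
- by apply: leq_trans small; rewrite leq_mul2r leq_mul2l It !orbT.
have [c cP] : exists c : 'I_s -> vertex G, forall k,
    [/\ c k \notin X, adj (f (Ordinal s0)) (c k) & adj (f k) (c k)].
  have h k := common_neighbour (f (Ordinal s0)) (f k) Xn.
  by have [c cP] := fin_all_exists h; exists c.
pose S := [set f k | k : 'I_s] :|: [set c k | k : 'I_s].
have fS k : f k \in S by rewrite inE imset_f.
have cS k : c k \in S by rewrite inE imset_f ?orbT.
have conc k : connect [rel u v in S | adj u v] (f (Ordinal s0)) (c k).
  by apply: connect1; have [_ ? _] := cP k; rewrite /= fS cS.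
exists S; split.
- apply: (connected_in_star (fS (Ordinal s0))) => y; rewrite inE.
  move=> /orP[]/imsetP[k _ ->] //; apply: connect_trans (conc k) _.
  by apply: connect1; have [_ _ ?] := cP k; rewrite /= fS cS adj_sym.
- apply/pred0P => z /=; apply/negP => /andP[zX]; rewrite inE.
  move=> /orP[]/imsetP[k _ zE]; move: zX; rewrite zE.
    by have := fX k; rewrite inE => /negbTE->.
  by have [/negbTE->] := cP k.
- apply: leq_trans (leq_card_setU _ _).1 _.
  have cI (h : 'I_s -> vertex G) : #|[set h k | k : 'I_s]| <= s.
    by apply: leq_trans (leq_imset_card _ _) _; rewrite card_ord.
  by have := cI f; have := cI c; lia.
- apply: leq_trans fund; rewrite leq_mul2l; apply/orP; right.
  apply/subset_leq_card/subsetP => v; rewrite !inE => /forallP h.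
  apply/forallP => k; rewrite inE; have := h (f k).
  by rewrite fS.
- move=> i; apply/subsetPn; have [k fk] := fU i.
  by exists (f k).
Qed.

(** Greedy: the new bag avoids the earlier ones, which cover at most [n/10] vertices, and touches
    each of them by not lying in its undominated set. Keeping these sets small is what lets the
    induction continue. *)
Lemma clique_model_of_size (j : nat) : 20 * (t * s) <= n -> j <= t ->
  exists B : nat -> {set vertex G},
    [/\ forall i, i < j ->
          [/\ connected_in (B i), #|B i| <= 2 * s
            & 2 ^ s * #|undominated (B i)| <= 4 * n],
        forall i k, i < k < j -> [disjoint B i & B k]
      & forall i k, i < k < j ->
          exists x y, [/\ x \in B i, y \in B k & adj x y]].
Proof.
move=> tsn; elim: j => [|j IH] jt.
  by exists (fun=> set0); split=> // i k; rewrite andbF.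
have [|B [Bi dB aB]] := IH; first exact: ltnW.
pose X := \bigcup_(i < j) B i.
have cX : #|X| <= t * (2 * s).
  apply: leq_trans (_ : j * (2 * s) <= _); last by rewrite leq_mul2r ltnW ?orbT.
  rewrite -[j in j * _]card_ord -sum_nat_const.
  apply: leq_trans (leq_card_bigcup_sum _ _) _; apply: leq_sum => i _.
  by have [] := Bi i (ltn_ord i).
have [||i|S [cS dS sS uS adjS]] :=
    @new_bag X 'I_j (fun i => undominated (B i)).
- by lia.
- by rewrite card_ord ltnW.
- by have [] := Bi i (ltn_ord i).
exists (fun i => if i == j then S else B i); split.
- by move=> i; rewrite ltnS leq_eqVlt; case: eqP => //= _; apply: Bi.
- move=> i k /andP[ik]; rewrite ltnS leq_eqVlt => /orP[/eqP kj|kj].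
    rewrite kj in ik *; rewrite eqxx (ltn_eqF ik).
    apply: disjointWl dS; exact: (bigcup_sup (Ordinal ik)).
  by rewrite !ltn_eqF //; [apply: dB; rewrite ik|apply: ltn_trans kj].
- move=> i k /andP[ik]; rewrite ltnS leq_eqVlt => /orP[/eqP kj|kj].
    rewrite kj in ik *; rewrite eqxx (ltn_eqF ik).
    have /subsetPn[y yS] := adjS (Ordinal ik).
    rewrite inE negb_forall => /existsP[x]; rewrite negb_imply negbK.
    by move=> /andP[xB xy]; exists x, y; rewrite adj_sym.
  by rewrite !ltn_eqF //; [apply: aB; rewrite ik|apply: ltn_trans kj].
Qed.

Lemma dense_clique_minor : 20 * (t * s) <= n ->
  graph_minor (complete_graph t) G.
Proof.
move=> tsn; have [B [Bi dB aB]] := clique_model_of_size tsn (leqnn t).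
exists (fun i : 'I_t => B i); split.
- by move=> i; have [] := Bi i (ltn_ord i).
- move=> i k; rewrite neq_ltn => /orP[] ik; last rewrite disjoint_sym.
    by apply: dB; rewrite ik ltn_ord.
  by apply: dB; rewrite ik ltn_ord.
- move=> i k; rewrite /= /complete_adj neq_ltn => /orP[] ik.
    by apply: aB; rewrite ik ltn_ord.
  have [|x [y [xB yB xy]]] := aB k i; first by rewrite ik ltn_ord.
  by exists y, x; rewrite adj_sym.
Qed.

End DenseGraph.

(* The Kostochka-Thomason bound: with [r ^ 2] about [log2 t], average degree
   [O(t * sqrt (log t))] forces a [K_t] minor. *)
Theorem clique_minor_free_arcs (G : sgraph) (t r : nat) :
  0 < t -> t <= 2 ^ (r * r) -> ~ graph_minor (complete_graph t) G ->
  arcs G <= 600 * (t * (r + 4)) * #|vertex G|.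
Proof.
move=> t0 tr; apply: contra_notT; rewrite -ltnNge => aG.
have G0 : 0 < #|vertex G|.
  by case: posnP aG (arcs_le G) => // ->; rewrite !muln0; lia.
have D200 : 200 <= 600 * (t * (r + 4)) by nia.
have [H [mH DH dH]] := dense_minor D200 G0 (ltnW aG).
(* With [s = r + 4], the exponents satisfy [r^2 + 3s + 1 <= s^2]; and [600 = 30 * 20] turns [DH]
   into [20 * (t * s) <= n]. *)
apply: graph_minor_trans mH; apply: (@dense_clique_minor H (r + 4)) => //.
- by nia.
- by rewrite addn4.
- rewrite (_ : 8 = 2 ^ 3) // -expnM.
  apply: leq_trans (_ : 2 ^ (r * r) * 2 ^ (3 * (r + 4)).+1 <= _).
    by rewrite expnS mulnCA -mulnA leq_mul2l leq_mul2r tr orbT.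
  by rewrite -expnD leq_exp2l //; nia.
- by lia.
Qed.

(** * Degenerate orders and star colourings *)

(** Filled from the end: a vertex with few neighbours in [X] goes last in [X]. *)
Lemma degenerate_order (T : finType) (e : rel T) (D : nat) :
  (forall X : {set T}, X != set0 ->
     exists2 v, v \in X & #|[set u in X | e u v]| <= D) ->
  exists pos : T -> nat,
    [/\ injective pos, forall v, pos v < #|T|
      & forall v, #|[set u | e u v & pos u < pos v]| <= D].
Proof.
move=> degen.
suff [pos [posI posT posD]] : exists pos : T -> nat,
    [/\ {in [set: T] &, injective pos},
        forall v, v \in [set: T] -> pos v < #|[set: T]|
      & forall v, v \in [set: T] ->
          #|[set u in [set: T] | e u v & pos u < pos v]| <= D].
  exists pos; split=> [u v|v|v]; first by apply: posI; rewrite inE.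
    by rewrite -cardsT posT // inE.
  have := posD v (in_setT v); congr (_ <= D).
  by apply: eq_card => u; rewrite !inE.
have [n] := ubnP #|[set: T]|; elim: n [set: T] => // n IH X Xn.
have [->|/degen[v vX dv]] := eqVneq X set0.
  by exists (fun=> 0); split=> [u w|w|w]; rewrite inE.
have cX : #|X| = #|X :\ v|.+1 by rewrite (cardsD1 v) vX.
have [|pos [posI posX posD]] := IH (X :\ v); first by rewrite -ltnS -cX.
pose pos' u := if u == v then #|X :\ v| else pos u.
have pos'X u : u \in X -> u != v -> pos u < #|X :\ v|.
  by move=> uX uv; apply: posX; rewrite !inE uv.
exists pos'; split.
- move=> u w uX wX; rewrite /pos'.
  have [->|uv] := eqVneq u v; have [->|wv] := eqVneq w v => //.
  + by move=> h; have := pos'X _ wX wv; rewrite -h ltnn.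
  + by move=> h; have := pos'X _ uX uv; rewrite h ltnn.
  + by apply: posI; rewrite !inE ?uv ?wv.
- move=> u uX; rewrite /pos' cX; case: eqP => [_|/eqP uv]; first exact: ltnSn.
  by apply: ltnW; rewrite ltnS pos'X.
- move=> w wX; have [wv|wv] := eqVneq w v.
    rewrite wv; apply: leq_trans dv; apply/subset_leq_card/subsetP => u.
    by rewrite !inE => /and3P[-> ->].
  have wX' : w \in X :\ v by rewrite !inE wv.
  apply: leq_trans (posD w wX'); apply/subset_leq_card/subsetP => u.
  rewrite !inE /pos' (negbTE wv) => /and3P[uX uw].
  have [_|uv] := eqVneq u v; last by rewrite uX uw.
  by move=> h; have := pos'X _ wX wv; lia.
Qed.

Lemma degenerate_coloring (T : finType) (e : rel T) (D : nat) :
  symmetric e -> irreflexive e ->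
  (forall X : {set T}, X != set0 ->
     exists2 v, v \in X & #|[set u in X | e u v]| <= D) ->
  exists c : T -> 'I_D.+1, forall u v, e u v -> c u != c v.
Proof.
move=> eS eI degen.
suff [c cP] : exists c : T -> 'I_D.+1,
    {in [set: T] &, forall u v, e u v -> c u != c v}.
  by exists c => u v; apply: cP; rewrite inE.
have [n] := ubnP #|[set: T]|; elim: n [set: T] => // n IH X Xn.
have [->|/degen[v vX dv]] := eqVneq X set0.
  by exists (fun=> ord0) => u w; rewrite inE.
have cX : #|X| = #|X :\ v|.+1 by rewrite (cardsD1 v) vX.
have [|c cP] := IH (X :\ v); first by rewrite -ltnS -cX.
have [k kP] : exists k, k \notin [set c u | u in [set u in X | e u v]].
  have : #|[set c u | u in [set u in X | e u v]]| < #|'I_D.+1|.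
    by rewrite card_ord ltnS (leq_trans (leq_imset_card _ _)).
  rewrite ltnNge => /negP h; apply/existsP; apply: contra_notT h.
  rewrite negb_exists => /forallP h; apply/subset_leq_card/subsetP => k _.
  by have := h k; rewrite negbK.
exists (fun u => if u == v then k else c u) => u w uX wX uw.
have [uv|uv] := eqVneq u v; have [wv|wv] := eqVneq w v.
- by rewrite uv wv eI in uw.
- apply: contraNneq kP => ->; apply: imset_f.
  by rewrite inE wX eS -uv.
- apply: contraNneq kP => <-; apply: imset_f.
  by rewrite inE uX -wv.
- by apply: cP; rewrite ?inE ?uv ?wv.
Qed.

Lemma exists_le_average (T : finType) (X : {set T}) (f : T -> nat) (K : nat) :
  X != set0 -> \sum_(v in X) f v <= K * #|X| -> exists2 v, v \in X & f v <= K.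
Proof.
move=> /set0Pn[x0 x0X] sX.
have [/existsP[v /andP[vX fv]]|] := boolP [exists v in X, f v <= K].
  by exists v.
rewrite negb_exists => /forallP h; exfalso.
have : \sum_(v in X) K.+1 <= \sum_(v in X) f v.
  by apply: leq_sum => v vX; have := h v; rewrite vX /= -ltnNge.
rewrite sum_nat_const; have : 0 < #|X| by apply/card_gt0P; exists x0.
by nia.
Qed.

Lemma leq_card_bigcup (I T : finType) (A : {set I}) (F : I -> {set T}) (m : nat) :
  (forall i, i \in A -> #|F i| <= m) -> #|\bigcup_(i in A) F i| <= m * #|A|.
Proof.
move=> h; rewrite mulnC -sum_nat_const.
by apply: leq_trans (leq_card_bigcup_sum _ _) _; apply: leq_sum.
Qed.

Lemma card_fibers (T I : finType) (A : {set T}) (f : T -> I) :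
  #|A| = \sum_i #|[set x in A | f x == i]|.
Proof.
rewrite -sum1_card (partition_big f xpredT) //=; apply: eq_bigr => i _.
by rewrite -sum1_card; apply: eq_bigl => x; rewrite inE.
Qed.

(** * Star colourings of graphs whose minors are all sparse *)

Section StarColoring.
Variables (G : sgraph) (D : nat).
Hypothesis sparse :
  forall H, graph_minor H G -> arcs H <= D * #|vertex H|.

Lemma sparse_degenerate (X : {set vertex G}) : X != set0 ->
  exists2 v, v \in X & #|[set u in X | adj u v]| <= D.
Proof.
move=> X0; have cX : 0 < #|vertex (induced X)| by rewrite card_induced card_gt0.
have [v dv] := exists_deg_le_average cX.
exists (val v); first exact: valP.
rewrite (eq_card (_ : _ =i [set u in X | adj (val v) u])); last first.
  by move=> u; rewrite !inE adj_sym.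
rewrite -deg_induced -(leq_pmul2l cX) (leq_trans dv) // mulnC.
exact: sparse (induced_minor X).
Qed.

Variable pos : vertex G -> nat.
Hypothesis pos_inj : injective pos.
Definition below (v : vertex G) := [set u | adj u v & pos u < pos v].
Hypothesis card_below : forall v, #|below v| <= D.

(** Only witnesses outside [X] matter here: those inside are counted directly in
    [card_ordered_conflicts]. *)
Definition fraternal_pairs (X : {set vertex G}) :=
  [set p in setX X X | (pos p.1 < pos p.2) &&
     [exists w, [&& w \notin X, p.1 \in below w & p.2 \in below w]]].

(* Give each pair a witness [w], and contract every [w] outside [X] to the
   vertex [g w] that is the first coordinate of most pairs witnessed by [w]:
   at least one pair in [D] becomes an edge of the resulting minor on [X]. *)
Lemma card_fraternal_pairs (X : {set vertex G}) :
  #|fraternal_pairs X| <= D * (D * #|X|).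
Proof.
set F := fraternal_pairs X.
pose wit (p : vertex G * vertex G) := odflt p.1
  [pick w | [&& w \notin X, p.1 \in below w & p.2 \in below w]].
have witP p : p \in F ->
    [/\ wit p \notin X, p.1 \in below (wit p) & p.2 \in below (wit p)].
  rewrite inE => /andP[_ /andP[_ /existsP[w hw]]]; rewrite /wit.
  by case: pickP => [w' /and3P[]|/(_ w)]; rewrite ?hw.
pose a w u := #|[set p in F | (wit p == w) && (p.1 == u)]|.
pose g w := [arg max_(u > w) a w u].
have gP w u : a w u <= a w (g w).
  by rewrite /g; case: arg_maxnP => // u' _; apply.
pose Fg := [set p in F | p.1 == g (wit p)].
(* Pairs witnessed by [w] have their first coordinate in [below w], so at most [D] values occur and
   [g w] is the most frequent. *)
have FFg : #|F| <= D * #|Fg|.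
  rewrite (card_fibers F wit) (card_fibers Fg wit) big_distrr /=.
  apply: leq_sum => w _.
  have -> : #|[set p in Fg | wit p == w]| = a w (g w).
    apply: eq_card => p; rewrite in_set [p \in Fg]in_set in_set -andbA.
    by congr (_ && _); rewrite andbC; case: eqP => // ->.
  rewrite (card_fibers _ (fun p => p.1)).
  apply: leq_trans (_ : \sum_(u in below w) a w u <= _).
    rewrite [X in _ <= X]big_mkcond /=; apply: leq_sum => u _.
    case: ifPn => [_|uw].
      by apply/subset_leq_card/subsetP => p; rewrite !in_set -andbA.
    rewrite leqn0 cards_eq0; apply/eqP/setP => p; rewrite [RHS]inE.
    apply/negP => /setIdP[/setIdP[pF /eqP pw] /eqP pu].
    by have [_] := witP _ pF; rewrite pw pu (negbTE uw).
  apply: leq_trans (_ : \sum_(u in below w) a w (g w) <= _).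
    exact: leq_sum.
  by rewrite sum_nat_const leq_mul2r card_below orbT.
apply: leq_trans FFg _; rewrite leq_mul2l; apply/orP; right.
(* Stars centred in [X]. Adjacency is demanded because [g w] is sure to be a neighbour of [w] only
   when [w] witnesses a pair. *)
pose B (x : {x | x \in X}) :=
  [set w | (w == val x) || [&& w \notin X, adj w (val x) & g w == val x]].
have xB x : val x \in B x by rewrite inE eqxx.
have mM : graph_minor (branch_graph B) G.
  apply: branch_graph_minor => [x|x y xy].
    apply: (connected_in_star (xB x)) => w wB; move: (wB); rewrite inE.
    move=> /orP[/eqP->|/and3P[_ wx _]] //; apply: connect1.
    by rewrite /= xB wB adj_sym.
  have xy' : val x != val y by [].
  apply/pred0P => w /=; apply/negP; rewrite !inE => /andP[].
  move=> /orP[/eqP wx|/and3P[wX _ /eqP wx]] /orP[/eqP wy|/and3P[wX' _ /eqP wy]].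
  - by rewrite -wx -wy eqxx in xy'.
  - by move: wX'; rewrite wx (valP x).
  - by move: wX; rewrite wy (valP y).
  - by rewrite -wx -wy eqxx in xy'.
apply: leq_trans (_ : arcs (branch_graph B) <= _); last first.
  by apply: leq_trans (sparse mM) _; rewrite /= card_sig.
pose f (p : {x | x \in X} * {x | x \in X}) := (val p.1, val p.2).
apply: leq_trans (leq_imset_card f _).
apply/subset_leq_card/subsetP => -[x y] /setIdP[pF /eqP pg].
have [wX xw yw] := witP _ pF.
move: pF; rewrite /F inE /= => /andP[/setXP[/= xX yX] /andP[xy _]].
pose u : {x | x \in X} := exist _ x xX; pose v : {x | x \in X} := exist _ y yX.
apply/imsetP; exists (u, v) => //; rewrite inE; apply/branch_adjP; split.
  by apply: contraTneq xy => /(congr1 val) /= ->; rewrite ltnn.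
move: xw yw; rewrite !inE => /andP[xw _] /andP[yw _].
exists (wit (x, y)), y; rewrite (xB v) adj_sym yw inE; split=> //.
by rewrite wX adj_sym xw -pg eqxx orbT.
Qed.

(** A proper colouring of this graph is a star colouring of [G]: on a two-coloured path of four
    vertices, the later middle vertex would have an earlier neighbour and another one of the same
    colour. *)
Definition conflict (u v : vertex G) :=
  (u != v) && (adj u v || [exists w, [&& adj u w, adj v w
                                       & (pos u < pos w) || (pos v < pos w)]]).

Lemma conflict_sym : symmetric conflict.
Proof.
move=> u v; rewrite /conflict eq_sym adj_sym; congr (_ && (_ || _)).
by apply: eq_existsb => w; rewrite andbCA [(pos u < _) || _]orbC.
Qed.

Lemma conflict_irr : irreflexive conflict.
Proof. by move=> u; rewrite /conflict eqxx. Qed.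

(** If [u] precedes [v], they are adjacent ([A]), or [u] precedes the common neighbour [w]. Then [w]
    precedes [v] ([T]), or follows both and lies in [X] ([F]) or outside (fraternal pairs). In all
    [D + 3 * D^2] per vertex of [X]. *)
Lemma card_ordered_conflicts (X : {set vertex G}) :
  #|[set p in setX X X | conflict p.1 p.2 & pos p.1 < pos p.2]|
    <= 4 * (D * D) * #|X|.
Proof.
set P := [set p in _ | _].
pose A := \bigcup_(v in X) setX (below v) [set v].
pose T := \bigcup_(v in X) \bigcup_(w in below v) setX (below w) [set v].
pose F := \bigcup_(w in X) setX (below w) (below w).
have cA : #|A| <= D * #|X|.
  by apply: leq_card_bigcup => v _; rewrite cardsX cards1 muln1.
have cT : #|T| <= D * D * #|X|.
  apply: leq_card_bigcup => v _.
  apply: leq_trans (_ : D * #|below v| <= _); last by rewrite leq_mul2l card_below orbT.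
  by apply: leq_card_bigcup => w _; rewrite cardsX cards1 muln1.
have cF : #|F| <= D * D * #|X|.
  by apply: leq_card_bigcup => w _; rewrite cardsX leq_mul.
have sub : P \subset A :|: T :|: (F :|: fraternal_pairs X).
  apply/subsetP => -[u v]; rewrite inE => /andP[/setXP[/= uX vX]].
  move=> /andP[/andP[_ /orP[uv|/existsP[w /and3P[uw vw lt]]]] luv].
    rewrite !in_setU; apply/orP; left; apply/orP; left; apply/bigcupP.
    by exists v => //; rewrite !inE /= uv luv eqxx.
  have {lt} luw : pos u < pos w by case/orP: lt => // /(ltn_trans luv).
  rewrite !in_setU; have [lwv|lvw|/pos_inj wv] := ltngtP (pos w) (pos v).
  - apply/orP; left; apply/orP; right; apply/bigcupP; exists v => //.
    by apply/bigcupP; exists w; rewrite !inE /= ?uw ?luw ?eqxx // adj_sym vw.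
  - apply/orP; right; have [wX|wX] := boolP (w \in X).
      apply/orP; left; apply/bigcupP; exists w => //.
      by rewrite !inE /= uw vw luw.
    apply/orP; right; rewrite inE inE /= uX vX luv; apply/existsP; exists w.
    by rewrite wX !inE uw vw luw.
  - by rewrite wv adj_irr in vw.
have cf := card_fraternal_pairs X.
have c1 := (leq_card_setU (A :|: T) (F :|: fraternal_pairs X)).1.
have c2 := (leq_card_setU A T).1.
have c3 := (leq_card_setU F (fraternal_pairs X)).1.
apply: leq_trans (subset_leq_card sub) _.
have : D * #|X| <= D * D * #|X|.
  by case: (posnP D) => [->|D0]; rewrite ?mul0n // leq_mul2r leq_pmull ?orbT.
by lia.
Qed.

Lemma conflict_degenerate (X : {set vertex G}) : X != set0 ->
  exists2 v, v \in X & #|[set u in X | conflict u v]| <= 8 * (D * D).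
Proof.
move=> X0; apply: exists_le_average => //.
have cP := card_ordered_conflicts X; set P := [set p in _ | _] in cP.
pose Q := [set p in setX X X | conflict p.1 p.2].
have -> : \sum_(v in X) #|[set u in X | conflict u v]| = #|Q|.
  rewrite (card_fibers Q (fun p => p.2)) [LHS]big_mkcond /=.
  apply: eq_bigr => v _; case: ifPn => vX.
    rewrite -(card_imset _ (_ : injective (fun u => (u, v)))); last by move=> ? ? [].
    apply: eq_card => -[x y]; rewrite !inE /=; apply/imsetP/idP.
      by move=> [u]; rewrite inE => /andP[uX uv] [-> ->]; rewrite uX vX uv eqxx.
    by move=> /andP[/andP[/andP[xX _] xy] /eqP yv]; exists x; rewrite ?inE ?xX -yv.
  apply/esym/eqP; rewrite cards_eq0; apply/eqP/setP => -[x y]; rewrite !inE /=.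
  by apply: contraNF vX => /andP[/andP[/andP[_ yX] _] /eqP<-].
pose sw (p : vertex G * vertex G) := (p.2, p.1).
have sub : Q \subset P :|: sw @: P.
  apply/subsetP => -[x y] /setIdP[/setXP[/= xX yX] xy].
  have [lt|lt|/pos_inj e] := ltngtP (pos x) (pos y).
  - by rewrite !inE /= xX yX xy lt.
  - rewrite in_setU; apply/orP; right; apply/imsetP; exists (y, x) => //.
    by rewrite !inE /= xX yX conflict_sym xy lt.
  - by rewrite e conflict_irr in xy.
apply: leq_trans (subset_leq_card sub) _.
have := (leq_card_setU P (sw @: P)).1; have := leq_imset_card sw P.
by lia.
Qed.

End StarColoring.

Lemma star_coloring (G : sgraph) (D : nat) :
  (forall H, graph_minor H G -> arcs H <= D * #|vertex H|) ->
  exists (pos : vertex G -> nat) (c : vertex G -> 'I_(8 * (D * D)).+1),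
    [/\ injective pos, forall v, pos v < #|vertex G|,
        forall u v, adj u v -> c u != c v
      & forall u v w, u != v -> adj u w -> adj v w -> pos u < pos w ->
          c u != c v].
Proof.
move=> sparse.
have [pos [posI posV posD]] := degenerate_order (sparse_degenerate sparse).
have [c cP] := degenerate_coloring (conflict_sym pos) (conflict_irr pos)
  (conflict_degenerate sparse posI posD).
exists pos, c; split=> // [u v uv|u v w uv uw vw lt]; apply: cP.
  by rewrite /conflict uv andbT; apply: contraTneq uv => ->; rewrite adj_irr.
rewrite /conflict uv /=; apply/orP; right; apply/existsP; exists w.
by rewrite uw vw lt.
Qed.

(** * Dimension *)

Section Dimension.
Context {d : Order.disp_t} (P : finPOrderType d).

(** Monotonicity makes the order together with all pairs of increasing height a partial order, which
    is then extended. *)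
Lemma linear_extension_of_height (h : P -> nat) :
  (forall x y : P, (x <= y)%O -> h x <= h y) ->
  exists L : {set P * P},
    [/\ linear_order L, forall x y : P, (x <= y)%O -> (x, y) \in L
      & forall x y, h x < h y -> (x, y) \in L].
Proof.
move=> mono; pose L0 := [set p : P * P | (p.1 <= p.2)%O || (h p.1 < h p.2)].
have [|L linL sL] := @linear_order_extend _ P L0.
  apply/partial_orderP; split=> [x|x y|x y z]; rewrite !inE /= ?lexx //.
    move=> /orP[xy|xy] /orP[yx|yx].
    - by apply/le_anti; rewrite xy yx.
    - by have := mono _ _ xy; lia.
    - by have := mono _ _ yx; lia.
    - by lia.
  move=> /orP[xy|xy] /orP[yz|yz].
  - by rewrite (le_trans xy yz).
  - by rewrite (leq_ltn_trans (mono _ _ xy) yz) orbT.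
  - by rewrite (leq_trans xy (mono _ _ yz)) orbT.
  - by rewrite (ltn_trans xy yz) orbT.
exists L; split=> // x y xy; apply: (subsetP sL); rewrite inE /= xy ?orbT //.
Qed.

(* Comparable elements have intersecting intervals, so reading the intervals
   from left to right, or from right to left, is compatible with the order. *)
Lemma interval_extension (l r : P -> nat) :
  (forall x y : P, (x >=< y)%O -> l x <= r y) ->
  exists L : {set P * P},
    [/\ linear_order L, forall x y : P, (x <= y)%O -> (x, y) \in L
      & forall x y, r x < l y -> (x, y) \in L].
Proof.
(* Maximising over the down-set makes [h] monotone, and [l x <= h x <= r x] because each [z] below
   [x] meets [x]. *)
move=> meet; pose h (x : P) := \max_(z | (z <= x)%O) l z.
have [|L [linL extL hL]] := @linear_extension_of_height h.
  move=> x y xy; apply/bigmax_leqP => z zx.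
  by apply: (@leq_bigmax_cond _ (fun z => (z <= y)%O)); apply: le_trans zx xy.
exists L; split=> // x y xy; apply: hL.
apply: (@leq_ltn_trans (r x)).
  by apply/bigmax_leqP => z zx; apply: meet; rewrite le_comparable.
by apply: leq_trans xy _; apply: (@leq_bigmax_cond _ (fun z => (z <= y)%O)).
Qed.

Lemma poset_dim_le_intervals (I : finType) (l r : I -> P -> nat) :
  0 < #|I| ->
  (forall i (x y : P), (x >=< y)%O -> l i x <= r i y) ->
  (forall x y : P, ~~ (x >=< y)%O ->
     exists i, (r i x < l i y) || (r i y < l i x)) ->
  poset_dim P <= 2 * #|I|.
Proof.
move=> I0 meet sep.
have ext (j : I * bool) : exists L : {set P * P},
    [/\ linear_order L, forall x y : P, (x <= y)%O -> (x, y) \in L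
      & forall x y, r j.1 x < l j.1 y ->
          (if j.2 then (x, y) else (y, x)) \in L].
  case: j => i [] /=; first exact: interval_extension (meet i).
  (* Mirror the intervals at [N]; as [N] bounds all right ends, truncated subtraction reverses
     them. *)
  pose N := \max_x r i x.
  have rN x : r i x <= N by apply: leq_bigmax.
  have [|L [linL extL sepL]] :=
      @interval_extension (fun x => N - r i x) (fun x => N - l i x).
    by move=> x y xy; have := meet i y x; rewrite comparable_sym xy => /(_ isT); lia.
  exists L; split=> // x y xy; apply: sepL.
  by have := meet i y y (comparablexx y); have := rN y; lia.
have [L LP] := fin_all_exists ext.
apply: leq_trans (_ : #|[set L j | j : I * bool]| <= _); last first.
  apply: leq_trans (leq_imset_card _ _) _.
  by rewrite card_prod card_bool mulnC.
have [_ dim_min] := poset_dimP P; apply: dim_min; apply/and3P; split.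
- have /card_gt0P[i _] := I0; apply/set0Pn; exists (L (i, true)).
  exact: imset_f.
- by apply/forall_inP => _ /imsetP[j _ ->]; have [] := LP j.
- rewrite eqEsubset; apply/andP; split; apply/subsetP => -[x y]; last first.
    rewrite inE /= => xy; apply/bigcapP => _ /imsetP[j _ ->].
    by have [_ h _] := LP j; apply: h.
  move=> /bigcapP inL; rewrite inE /=.
  have {}inL j : (x, y) \in L j by apply: inL; apply: imset_f.
  have anti j : (y, x) \in L j -> x = y.
    have [/andP[/partial_orderP[_ h _] _] _ _] := LP j.
    exact: h.
  have [cxy|/sep[i /orP[] lt]] := boolP (x >=< y)%O.
  - case/orP: cxy => // yx; have /card_gt0P[i _] := I0.
    by rewrite (@anti (i, true)) //; have [_ h _] := LP (i, true); apply: h.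
  - by rewrite (@anti (i, false)) //; have [_ _ h] := LP (i, false); apply: h.
  - by rewrite (@anti (i, true)) //; have [_ _ h] := LP (i, true); apply: h.
Qed.

(* A vertex with a neighbour of colour [i] before it has no other neighbour
   of colour [i].  For each colour [i], put the vertices of that colour at
   their positions, and let each other vertex cover everything from its
   earlier neighbour of colour [i] to infinity (or to 0, in the second family);
   if there is none, from its own position to infinity. *)
Lemma poset_dim_le_coloring (k : nat) (pos : P -> nat) (c : P -> 'I_k) (n : nat) :
  0 < k -> injective pos -> (forall v, pos v < n) ->
  (forall u v, comparability_adj u v -> c u != c v) ->
  (forall u v w, u != v -> comparability_adj u w -> comparability_adj v w ->
     pos u < pos w -> c u != c v) ->
  poset_dim P <= 4 * k.
Proof.
move=> k0 posI posn proper star.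
pose parent (i : 'I_k) (w : P) :=
  [pick p | [&& comparability_adj p w, c p == i & pos p < pos w]].
pose l (j : 'I_k * bool) (w : P) :=
  if c w == j.1 then pos w else
  if j.2 then (if parent j.1 w is Some p then pos p else pos w) else 0.
(* [n] plays infinity. In the second family a vertex of another colour without parent covers
   everything. *)
pose r (j : 'I_k * bool) (w : P) :=
  if c w == j.1 then pos w else
  if j.2 then n else (if parent j.1 w is Some p then pos p else n).
have cI : #|{: 'I_k * bool}| = k * 2 by rewrite card_prod card_ord card_bool.
(* By [star], a parent is the only neighbour of colour [i]; without one, all such neighbours come
   later. *)
have parentP i w u : comparability_adj u w -> c u = i ->
    match parent i w with Some p => p = u | None => pos w < pos u end.
  move=> uw cu; rewrite /parent; case: pickP => [p /and3P[pw /eqP cp lt]|/(_ u)].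
    have [//|pu] := eqVneq p u.
    by have := star p u w pu pw uw lt; rewrite cp cu eqxx.
  rewrite uw cu eqxx /= => /negbT; rewrite -leqNgt leq_eqVlt => /orP[/eqP/posI e|//].
  by rewrite e comparability_adj_irr in uw.
apply: leq_trans (@poset_dim_le_intervals _ l r _ _ _) _; last by rewrite cI; lia.
- by rewrite cI muln_gt0 k0.
- move=> [i b] x y cxy; rewrite /l /r /=.
  have [->|xNy] := eqVneq x y.
    by case: eqP => // _; case: b; case: (parent i y) => [p|] //; apply: ltnW (posn _).
  have xy : comparability_adj x y by rewrite /comparability_adj xNy cxy.
  have yx : comparability_adj y x by rewrite comparability_adj_sym.
  case: (eqVneq (c x) i) => cx; case: (eqVneq (c y) i) => cy.
  + by have := proper _ _ xy; rewrite cx cy eqxx.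
  + have := parentP i y x xy cx; case: b; first by move=> _; apply: ltnW (posn _).
    by case: (parent i y) => [p ->|_] //; apply: ltnW (posn _).
  + have := parentP i x y yx cy; case: b => //.
    by case: (parent i x) => [p ->|/ltnW].
  + case: b => //; by case: (parent i x) => [p|]; apply: ltnW (posn _).
- suff sep (u w : P) : ~~ (u >=< w)%O -> pos u < pos w ->
      exists j, (r j u < l j w) || (r j w < l j u).
    move=> x y nxy; have [lt|lt|/posI e] := ltngtP (pos x) (pos y).
    + exact: sep.
    + have [|j h] := sep y x _ lt; first by rewrite comparable_sym.
      by exists j; rewrite orbC.
    + by rewrite e comparablexx in nxy.
  (* The colour of the earlier vertex separates: the first family does so unless [w] has a parent
     before [u], and then the second does. The parent is not [u], which is incomparable to [w]. *)
  move=> nuw lt; pose i := c u.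
  have [cw|cw] := eqVneq (c w) i.
    by exists (i, true); rewrite /l /r /= cw eqxx lt.
  case E: (parent i w) => [p|]; last first.
    by exists (i, true); rewrite /l /r /= (negbTE cw) E eqxx lt.
  move: (E); rewrite /parent; case: pickP => // p' /and3P[pw _ _] [p'p]; subst p'.
  have [ltp|ltp|/posI e] := ltngtP (pos u) (pos p).
  + by exists (i, true); rewrite /l /r /= (negbTE cw) E eqxx ltp.
  + by exists (i, false); rewrite /l /r /= (negbTE cw) E eqxx ltp orbT.
  + by move: pw; rewrite -e /comparability_adj (negbTE nuw) andbF.
Qed.

End Dimension.

(** * Dimension bounds from sparse and clique-minor-free comparability graphs *)

Lemma poset_dim_le_arcs (d : Order.disp_t) (P : finPOrderType d) (D : nat) :
  (forall H, graph_minor H (comparability_graph P) -> arcs H <= D * #|vertex H|) ->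
  poset_dim P <= 32 * (D * D) + 4.
Proof.
move=> /star_coloring[pos [c [posI posn proper star]]].
apply: leq_trans (poset_dim_le_coloring _ posI posn proper star) _ => //.
by lia.
Qed.

(** [q] stands in for [log2 t]: with [r] least such that [t <= 2 ^ (r * r)], take [q = (r - 1)^2].
    Then [(r + 4)^2 <= 2q + 50], and [32 * D^2 + 4 <= 36 * D^2] explains the factor 36. *)
Lemma poset_dim_le_clique_minor_free :
  exists2 K : nat, 0 < K &
    forall (t : nat) (d : Order.disp_t) (P : finPOrderType d), 2 <= t ->
    ~ graph_minor (complete_graph t) (comparability_graph P) ->
    exists2 q, 2 ^ q <= t & poset_dim P <= K * (t * t * (2 * q + 50)).
Proof.
exists (36 * (600 * 600)) => [|t d P t2 free]; first by rewrite !muln_gt0.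
have [|r tr minr] := @ex_minnP (fun r => t <= 2 ^ (r * r)).
  by exists t; rewrite ltnW // (leq_trans (ltn_expl t (ltnSn 1))) // leq_exp2l // leq_pmulr //; lia.
have r0 : 0 < r by case: r tr {minr} => //; rewrite muln0 expn0; lia.
exists (r.-1 * r.-1).
  by rewrite ltnW // ltnNge; apply/negP => /minr; lia.
have sparse H : graph_minor H (comparability_graph P) ->
    arcs H <= 600 * (t * (r + 4)) * #|vertex H|.
  move=> mH; apply: clique_minor_free_arcs tr _; first by lia.
  by move=> mt; apply: free; apply: graph_minor_trans mt mH.
apply: leq_trans (poset_dim_le_arcs sparse) _.
case: r r0 {tr minr sparse} => // s _ /=; rewrite addSnnS.
have hs : (s + 5) * (s + 5) <= 2 * (s * s) + 50.
  by have := (nat_Cauchy s 5).1; rewrite -!mulnn; nia.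
move: (s + 5) (2 * (s * s) + 50) (addn_gt0 s 5) hs => b a; rewrite orbT => b0 hs.
have : 0 < 600 by []; move: 600 => c c0.
rewrite [c * (t * b) * _]mulnACA [t * b * _]mulnACA.
apply: leq_trans (_ : 36 * (c * c) * (t * t * (b * b)) <= _); last first.
  by rewrite !leq_mul2l hs !orbT.
have : 0 < c * c * (t * t * (b * b)) by rewrite !muln_gt0; lia.
by rewrite -mulnA; lia.
Qed.

From mathcomp Require Import all_classical all_reals all_analysis.

Import Order.TTheory GRing.Theory Num.Theory.
Local Open Scope ring_scope.

Theorem theorem3 (R : realType) :
  exists2 C : R, 0 < C &
    forall t : nat, (2 <= t)%N ->
    forall (d : Order.disp_t) (P : finPOrderType d),
      ~ graph_minor (complete_graph t) (comparability_graph P) ->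
      (poset_dim P)%:R <= C * t%:R ^+ 2 * ln (t%:R : R).
Proof.
have l2 : 0 < ln (2 : R) by rewrite ln_gt0 // ltr1n.
have [K K0 dimK] := poset_dim_le_clique_minor_free.
(* Both [q] and 1 are at most [ln t / ln 2], so [2q + 50] is at most 52 times it. *)
exists (K%:R * 52 / ln 2); first by rewrite divr_gt0 // mulr_gt0 // ltr0n.
move=> t t2 d P free; have [q qt dimq] := dimK t d P t2 free.
have t0 : (0 < t%:R :> R) by rewrite ltr0n; apply: leq_trans t2.
have lt2 : ln 2 <= ln t%:R :> R by rewrite ler_ln ?posrE // ler_nat.
have lq : q%:R * ln 2 <= ln t%:R :> R.
  rewrite mulr_natl -lnXn //.
  by rewrite ler_ln ?posrE ?exprn_gt0 // -natrX ler_nat.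
have hq : 2 * q%:R + 50 <= 52 * (ln t%:R / ln 2) :> R.
  rewrite mulrA ler_pdivlMr //; lra.
have -> : K%:R * 52 / ln 2 * t%:R ^+ 2 * ln t%:R =
    K%:R * (t%:R * t%:R * (52 * (ln t%:R / ln 2))) :> R by ring.
apply: (@le_trans _ _ (K * (t * t * (2 * q + 50)))%:R).
  by rewrite ler_nat.
rewrite !natrM natrD natrM; do !apply: ler_wpM2l => //.
Qed.
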